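(* Let $R$ be a Noetherian local ring or a finitely generated graded $K$-algebra over a field $K$. Let $j\ge 2$ be an integer, and let $I\subsetneq R$ be a proper radical ideal with $\mathrm{grade}\,I\ge j$. If $\mathrm{Fitt}_{j-1}(I)=I$, then $I$ is an unmixed ideal of grade $j$ and $R_P$ is a regular ring for all $P\in \mathrm{Ass}\, I$.
   Context: For a finitely generated module $M$ over a Noetherian ring $R$, choose a finite free presentation $G\to F\to M\to 0$ with $\mathrm{rank}\,F=r$, and let $A$ be a matrix representing $G\to F$. The $j$th Fitting ideal of $M$ is $\mathrm{Fitt}_j(M)=I_{r-j}(A)$, where $I_t(A)$ is the ideal generated by the $t$-minors of $A$, with $I_t(A)=R$ for $t\le 0$. This is independent of the choices. An ideal $I$ is regarded as an $R$-module. $\mathrm{grade}\,I$ is the length of a maximal $R$-regular sequence contained in $I$. $\mathrm{Ass}\,I$ denotes the set of associated primes of $R/I$. The ideal $I$ is unmixed if all its associated primes have the same height, equal to $\mathrm{height}\, I$. *)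

(* Defs.v *)
From HB Require Import structures.
From mathcomp Require Import all_boot all_order all_algebra generic_quotient.
From mathcomp Require Import all_classical.
From mathcomp Require Import ring.

Set Implicit Arguments.
Unset Strict Implicit.
Unset Printing Implicit Defensive.

Import GRing.Theory.
Local Open Scope ring_scope.
Local Open Scope classical_set_scope.

Section Ideals.
Variable R : comNzRingType.
Implicit Types (I m : set R) (s : seq R).

Definition is_ideal I := I 0 /\ forall a x y, I x -> I y -> I (a * x + y).

Definition is_proper_ideal I := is_ideal I /\ ~ I 1.

Definition is_maximal_ideal m :=
  is_proper_ideal m /\ forall J, is_proper_ideal J -> m `<=` J -> J = m.

Definition is_prime_ideal I :=
  is_proper_ideal I /\ forall x y, I (x * y) -> I x \/ I y.

Definition is_radical_ideal I := is_ideal I /\ forall x n, I (x ^+ n) -> I x.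

Definition ideal_gen (X : set R) : set R := smallest is_ideal X.

Definition noetherian :=
  forall I, is_ideal I -> exists s, I = ideal_gen [set` s].

Definition unique_maximal_ideal m := forall m', is_maximal_ideal m' <-> m' = m.

Definition noetherian_local := noetherian /\ exists m, unique_maximal_ideal m.

(* [take i s] generates the ideal (s_0, ..., s_{i-1}), so the first clause says
   that s_i is a nonzerodivisor on R / (s_0, ..., s_{i-1}). *)
Definition regular_sequence s :=
  (forall i, (i < size s)%N -> forall y,
     ideal_gen [set` take i s] (s`_i * y) -> ideal_gen [set` take i s] y)
  /\ ~ ideal_gen [set` s] 1.

Definition maximal_regular_sequence_in I s :=
  [/\ regular_sequence s, [set` s] `<=` I
    & forall x, I x -> ~ regular_sequence (rcons s x)].

(* In a Noetherian ring, the maximal regular sequences contained in a proper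
   ideal exist and all have the same length (Rees). *)
Definition grade I : nat :=
  xget 0%N [set n | exists s, maximal_regular_sequence_in I s /\ size s = n].

Record spec := Spec { spec_set :> set R; specP : is_prime_ideal spec_set }.

(* c 0 < c 1 < ... < c n, a chain of length n; c is irrelevant beyond n. *)
Definition prime_chain (c : nat -> spec) (n : nat) :=
  forall i, (i < n)%N -> c i `<` c i.+1.

Definition chain_lengths : set nat := [set n | exists c, prime_chain c n].

Definition chain_lengths_to (P : spec) : set nat :=
  [set n | exists2 c, prime_chain c n & c n = P].

(* Krull dimension and heights are relations: they hold of no natural number
   exactly when the value is infinite. *)
Definition krull_dim (d : nat) := (chain_lengths `&` ubound chain_lengths) d.

Definition prime_height (P : spec) (h : nat) :=
  (chain_lengths_to P `&` ubound (chain_lengths_to P)) h.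

Definition heights_above I : set nat :=
  [set h | exists P : spec, I `<=` P /\ prime_height P h].

Definition height I (h : nat) := (heights_above I `&` lbound (heights_above I)) h.

(* The associated primes of R / I: [set a | I (a * x)] is the annihilator of
   the class of x in R / I. *)
Definition Ass I : set spec :=
  [set P | exists x, spec_set P = [set a | I (a * x)]].

Definition unmixed I :=
  exists h, height I h /\ forall P, Ass I P -> prime_height P h.

Definition generator_numbers I : set nat :=
  [set n | exists s, size s = n /\ I = ideal_gen [set` s]].

Definition min_generators I (n : nat) :=
  (generator_numbers I `&` lbound (generator_numbers I)) n.

Definition regular_local :=
  noetherian /\ exists m d,
    [/\ unique_maximal_ideal m, krull_dim d & min_generators m d].

End Ideals.

Section Fitting.
Variable R : comNzRingType.

(* Both selections are injective but not required to be increasing; this only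
   changes the signs of the minors.  For t = 0 the only minor is 1. *)
Definition minors_ideal (t : nat) (p q : nat) (A : 'M[R]_(p, q)) : set R :=
  ideal_gen [set d | exists (f : 'I_t -> 'I_p) (g : 'I_t -> 'I_q),
    [/\ injective f, injective g & d = \det (mxsub f g A)]].

(* The row vectors R^s -> R^r -> N -> 0, the first map being u |-> u *m A, form
   an exact sequence; the submodule N of V stands for the module presented. *)
Definition presentation (V : lmodType R) (N : set V) (r s : nat)
    (pi : {linear 'rV[R]_r -> V}) (A : 'M[R]_(s, r)) :=
  range pi = N /\ [set v | pi v = 0] = range (fun u : 'rV[R]_s => u *m A).

(* The ideal does not depend on the presentation chosen.  Truncated subtraction
   gives minors_ideal 0 A = R when r <= j. *)
Definition Fitt (V : lmodType R) (N : set V) (j : nat) : set R :=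
  xget set0 [set J | exists (r s : nat) (pi : {linear 'rV[R]_r -> V})
    (A : 'M[R]_(s, r)), presentation N pi A /\ J = minors_ideal (r - j) A].

End Fitting.

Section GradedAlgebras.
Variables (K : fieldType) (R : comNzRingType) (iota : {rmorphism K -> R}).

Definition is_subalgebra (S : set R) :=
  [/\ range iota `<=` S, forall x y, S x -> S y -> S (x - y)
    & forall x y, S x -> S y -> S (x * y)].

Definition fg_algebra := exists s : seq R, smallest is_subalgebra [set` s] = setT.

Definition homogeneous_decomposition (D : int -> set R) (x : R) (c : int -> R) :=
  [/\ forall i, D i (c i), finite_set [set i | c i != 0]
    & x = \sum_(i \in [set: int]) c i].

(* Z-graded, which includes the N-graded algebras (D i = 0 for i < 0). *)
Definition is_grading (D : int -> set R) :=
  [/\ forall i, D i 0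
        /\ forall a x y, D i x -> D i y -> D i (iota a * x + y),
      forall i k x y, D i x -> D k y -> D (i + k) (x * y),
      D 0 1
    & forall x, exists! c, homogeneous_decomposition D x c].

End GradedAlgebras.

(* A K-algebra structure on R is given by its structure morphism K -> R. *)
Definition fg_graded_algebra (R : comNzRingType) :=
  exists (K : fieldType) (iota : {rmorphism K -> R}),
    fg_algebra iota /\ exists D, is_grading iota D.

(* Localization at a prime ideal; an element of [fraction P] stands for n / d,
   and n / d = n' / d' iff u (n d' - n' d) = 0 for some u outside P. *)
Module Localization.
Section Localization.
Variables (R : comNzRingType) (P : spec R).
Local Open Scope quotient_scope.

Definition den := {d : R | d \notin spec_set P}.
Definition fraction := (R * den)%type.
Implicit Types (x y z : fraction) (d e : den).

Lemma denP (d : R) : (d \notin spec_set P) <-> ~ spec_set P d.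
Proof. by rewrite notin_setE. Qed.

Lemma den1_subproof : 1 \notin spec_set P.
Proof. by apply/denP; case: (specP P) => [[]]. Qed.

Lemma denM_subproof d e : sval d * sval e \notin spec_set P.
Proof.
case: d e => d /denP Pd [e /denP Pe] /=; apply/denP.
by case: (specP P) => _ + Pde => /(_ _ _ Pde) [].
Qed.

Definition den1 : den := exist _ 1 den1_subproof.
Definition denM d e : den := exist _ (sval d * sval e) (denM_subproof d e).

Definition equivl x y : bool :=
  `[< exists u : den, sval u * (x.1 * sval y.2) = sval u * (y.1 * sval x.2) >].

Lemma equivl_refl : reflexive equivl.
Proof. by move=> x; apply/asboolP; exists den1. Qed.

Lemma equivl_sym : symmetric equivl.
Proof. by move=> x y; apply/asboolP/asboolP => -[u eq_u]; exists u. Qed.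

Lemma equivl_trans : transitive equivl.
Proof.
move=> y x z /asboolP[u eq_u] /asboolP[v eq_v]; apply/asboolP.
exists (denM (denM u v) y.2) => /=.
transitivity (sval u * (x.1 * sval y.2) * (sval v * sval z.2)); first by ring.
rewrite eq_u.
transitivity (sval v * (y.1 * sval z.2) * (sval u * sval x.2)); first by ring.
by rewrite eq_v; ring.
Qed.

Canonical equivl_equiv := EquivRel equivl equivl_refl equivl_sym equivl_trans.

Definition type := {eq_quot equivl}.

HB.instance Definition _ : EqQuotient _ equivl type := EqQuotient.on type.
HB.instance Definition _ := Choice.on type.

Lemma equivlP x y :
  reflect (exists u : den, sval u * (x.1 * sval y.2) = sval u * (y.1 * sval x.2))
    (x == y %[mod type]).
Proof. by rewrite eqmodE; apply: asboolP. Qed.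

Lemma pi_eq x y :
  (exists u : den, sval u * (x.1 * sval y.2) = sval u * (y.1 * sval x.2)) ->
  \pi_type x = \pi_type y.
Proof. by move=> /equivlP /eqP. Qed.

Lemma pi_eq1 x y : x.1 * sval y.2 = y.1 * sval x.2 -> \pi_type x = \pi_type y.
Proof. by move=> eq_xy; apply: pi_eq; exists den1; rewrite eq_xy. Qed.

Lemma reprP x : exists u : den,
  sval u * (x.1 * sval (repr (\pi_type x)).2)
    = sval u * ((repr (\pi_type x)).1 * sval x.2).
Proof. by apply/equivlP; rewrite reprK. Qed.

Definition zerol : fraction := (0, den1).
Definition onel : fraction := (1, den1).
Definition addl x y : fraction :=
  (x.1 * sval y.2 + y.1 * sval x.2, denM x.2 y.2).
Definition oppl x : fraction := (- x.1, x.2).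
Definition mull x y : fraction := (x.1 * y.1, denM x.2 y.2).

Definition zero : type := \pi_type zerol.
Definition one : type := \pi_type onel.
Definition add := lift_op2 type addl.
Definition opp := lift_op1 type oppl.
Definition mul := lift_op2 type mull.

Lemma pi_add : {morph \pi : x y / addl x y >-> add x y}.
Proof.
move=> x y; unlock add; apply: pi_eq.
have [u eq_u] := reprP x; have [v eq_v] := reprP y.
move: (repr _) (repr _) eq_u eq_v => y' x' eq_u eq_v.
exists (denM u v) => /=.
transitivity (sval u * (x.1 * sval x'.2) * (sval v * sval y.2 * sval y'.2)
  + sval v * (y.1 * sval y'.2) * (sval u * sval x.2 * sval x'.2)); first by ring.
by rewrite eq_u eq_v; ring.
Qed.
Canonical pi_add_morph := PiMorph2 pi_add.

Lemma pi_opp : {morph \pi : x / oppl x >-> opp x}.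
Proof.
move=> x; unlock opp; apply: pi_eq.
have [u eq_u] := reprP x; move: (repr _) eq_u => x' eq_u.
by exists u => /=; rewrite !mulNr !mulrN eq_u.
Qed.
Canonical pi_opp_morph := PiMorph1 pi_opp.

Lemma pi_mul : {morph \pi : x y / mull x y >-> mul x y}.
Proof.
move=> x y; unlock mul; apply: pi_eq.
have [u eq_u] := reprP x; have [v eq_v] := reprP y.
move: (repr _) (repr _) eq_u eq_v => y' x' eq_u eq_v.
exists (denM u v) => /=.
transitivity (sval u * (x.1 * sval x'.2) * (sval v * (y.1 * sval y'.2))).
  by ring.
by rewrite eq_u eq_v; ring.
Qed.
Canonical pi_mul_morph := PiMorph2 pi_mul.

Lemma addA : associative add.
Proof.
elim/quotW=> x; elim/quotW=> y; elim/quotW=> z; rewrite !piE.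
by apply: pi_eq1 => /=; ring.
Qed.

Lemma addC : commutative add.
Proof.
by elim/quotW=> x; elim/quotW=> y; rewrite !piE; apply: pi_eq1 => /=; ring.
Qed.

Lemma add0 : left_id zero add.
Proof.
by elim/quotW=> x; rewrite /zero !piE; apply: pi_eq1 => /=; ring.
Qed.

Lemma addN : left_inverse zero opp add.
Proof.
by elim/quotW=> x; rewrite /zero !piE; apply: pi_eq1 => /=; ring.
Qed.

HB.instance Definition _ := GRing.isZmodule.Build type addA addC add0 addN.

Lemma mulA : associative mul.
Proof.
elim/quotW=> x; elim/quotW=> y; elim/quotW=> z; rewrite !piE.
by apply: pi_eq1 => /=; ring.
Qed.

Lemma mulC : commutative mul.
Proof.
by elim/quotW=> x; elim/quotW=> y; rewrite !piE; apply: pi_eq1 => /=; ring.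
Qed.

Lemma mul1 : left_id one mul.
Proof.
by elim/quotW=> x; rewrite /one !piE; apply: pi_eq1 => /=; ring.
Qed.

Lemma mulD : left_distributive mul add.
Proof.
elim/quotW=> x; elim/quotW=> y; elim/quotW=> z; rewrite !piE.
by apply: pi_eq1 => /=; ring.
Qed.

Lemma one_neq0 : one != zero.
Proof.
apply/negP => /equivlP[u] /=; rewrite !mulr1 mulr0 => u0.
have : sval u \notin spec_set P := valP u.
by rewrite u0 => /denP; case: (specP P) => [[[]]].
Qed.

HB.instance Definition _ :=
  GRing.Zmodule_isComNzRing.Build type mulA mulC mul1 mulD one_neq0.

End Localization.
End Localization.
HB.export Localization.

Definition localization (R : comNzRingType) (P : spec R) : comNzRingType :=
  Localization.type P.

(* Main.v *)
From HB Require Import structures.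
Require Import Defs.
From mathcomp Require Import all_boot all_order all_algebra.
From mathcomp Require Import all_classical.
From mathcomp Require Import fingroup perm ring zify.

Set Implicit Arguments.
Unset Strict Implicit.
Unset Printing Implicit Defensive.

Import GRing.Theory.
Local Open Scope ring_scope.
Local Open Scope classical_set_scope.

(** Hilbert's basis theorem makes R Noetherian in both cases. Let n be the grade
    of I and P an associated prime of I. Since I is radical, P is the colon
    ideal (I : x) for some x outside P, so that I and P agree locally at P.

    A regular sequence of length n in I gives a chain of primes of length n
    below every prime containing I ([regular_sequence_chain]). On the other
    hand, present I by a matrix A with r columns and choose a set G of
    generators of minimal size among those that generate I locally at P. If G
    had more than j elements, then A would have rank at most r - j - 1 modulo P,
    and its minors of size r - j + 1 would all lie in P^2 locally
    ([minors_in_square]). These minors generate Fitt_(j-1)(I) = I, which is P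
    locally, so Nakayama's lemma would make P vanish locally, although I
    contains a nonzerodivisor. So at most j elements generate P locally
    ([few_local_generators]), and by Krull's height theorem ([height_theorem])
    no chain of primes ending at P is longer than that.

    Comparing both bounds, n <= j, hence n = j since the grade is at least j.
    Every associated prime has height j, every prime containing I has height at
    least j, and the maximal ideal of the local ring at P is generated by as
    many elements as the dimension ([local_regular]).

    Statements about the local ring at P are proved inside R, by allowing
    denominators outside P; that ring itself appears only in the proof of its
    regularity. *)

Identity Coercion fun_of_set : set >-> Funclass.

(** * Ideals of a Noetherian ring *)

Section IdealTheory.
Variable R : comNzRingType.
Implicit Types (I J E L M N : set R) (P Q : spec R) (X : set R).

Lemma ideal0 I : is_ideal I -> I 0.
Proof. by case. Qed.

Lemma idealD I x y : is_ideal I -> I x -> I y -> I (x + y).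
Proof. by move=> [_ h] Ix Iy; rewrite -[x]mul1r; apply: h. Qed.

Lemma idealM I a x : is_ideal I -> I x -> I (a * x).
Proof. by move=> [h0 h] Ix; rewrite -[a * x]addr0; apply: h. Qed.

Lemma idealN I x : is_ideal I -> I x -> I (- x).
Proof. by move=> hI Ix; rewrite -mulN1r; apply: idealM. Qed.

Lemma idealB I x y : is_ideal I -> I x -> I y -> I (x - y).
Proof. by move=> hI Ix Iy; apply: idealD => //; apply: idealN. Qed.

Lemma ideal_sum I (T : Type) (r : seq T) (B : pred T) (F : T -> R) :
  is_ideal I -> (forall i, B i -> I (F i)) -> I (\sum_(i <- r | B i) F i).
Proof.
by move=> hI hF; elim/big_ind: _ => // [|x y]; [apply: ideal0|apply: idealD].
Qed.

Lemma ideal_gen_ideal X : is_ideal (ideal_gen X).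
Proof.
split=> [A [[]] //|a x y hx hy A hA].
by case: (hA) => [[_ h] _]; apply: h; [apply: hx|apply: hy].
Qed.

Lemma sub_ideal_gen X : X `<=` ideal_gen X.
Proof. by move=> x Xx A [_]; apply. Qed.

Lemma ideal_gen_sub X J : is_ideal J -> X `<=` J -> ideal_gen X `<=` J.
Proof. by move=> hJ XJ x; apply; split. Qed.

Lemma ideal_genS X Y : X `<=` Y -> ideal_gen X `<=` ideal_gen Y.
Proof.
move=> XY; apply: ideal_gen_sub; first exact: ideal_gen_ideal.
by move=> x /XY; apply: sub_ideal_gen.
Qed.

Definition adjoin I x : set R := [set z | exists c y, I y /\ z = c * x + y].

Lemma adjoin_ideal I x : is_ideal I -> is_ideal (adjoin I x).
Proof.
move=> hI; split; first by exists 0, 0; split; [apply: ideal0|ring].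
move=> a u v [c [y [Iy ->]]] [d [z [Iz ->]]]; exists (a * c + d), (a * y + z).
by split; [apply: idealD => //; apply: idealM|ring].
Qed.

Lemma sub_adjoin I x : I `<=` adjoin I x.
Proof. by move=> y Iy; exists 0, y; split=> //; ring. Qed.

Lemma adjoin_mem I x : is_ideal I -> adjoin I x x.
Proof. by move=> hI; exists 1, 0; split; [apply: ideal0|ring]. Qed.

Definition colon I e : set R := [set a | I (a * e)].

Lemma colon_ideal I e : is_ideal I -> is_ideal (colon I e).
Proof.
move=> hI; split; first by rewrite /colon /= mul0r; apply: ideal0.
move=> a x y Ix Iy; rewrite /colon /= mulrDl -mulrA.
by apply: idealD => //; apply: idealM.
Qed.

Lemma spec_ideal P : is_ideal P. Proof. by case: (specP P) => [[]]. Qed.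

Lemma spec_1 P : ~ P 1. Proof. by case: (specP P) => [[]]. Qed.

Lemma spec_prime P x y : P (x * y) -> P x \/ P y.
Proof. by case: (specP P) => _; apply. Qed.

Lemma spec_notM P x y : ~ P x -> ~ P y -> ~ P (x * y).
Proof. by move=> Px Py /spec_prime[]. Qed.

Lemma spec_X P x n : P (x ^+ n) -> P x.
Proof.
elim: n => [|n IH]; first by rewrite expr0 => /spec_1.
by rewrite exprS => /spec_prime[].
Qed.

(** The contraction to R of the extension of E to the local ring at P. Working
    with it keeps local arguments inside R. *)
Definition saturation P E : set R := [set z | exists s, ~ P s /\ E (s * z)].

Lemma saturation_ideal P E : is_ideal E -> is_ideal (saturation P E).
Proof.
move=> hE; split.
  by exists 1; rewrite mulr0; split; [apply: spec_1|apply: ideal0].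
move=> a x y [s [Ps Ex]] [t [Pt Ey]]; exists (s * t).
split; first exact: spec_notM.
have -> : s * t * (a * x + y) = (t * a) * (s * x) + s * (t * y) by ring.
by apply: idealD => //; apply: idealM.
Qed.

Lemma sub_saturation P E : E `<=` saturation P E.
Proof. by move=> x Ex; exists 1; rewrite mul1r; split=> //; apply: spec_1. Qed.

Lemma saturationK P E s x :
  ~ P s -> saturation P E (s * x) -> saturation P E x.
Proof.
move=> Ps [t [Pt h]]; exists (t * s); rewrite -mulrA; split=> //.
exact: spec_notM.
Qed.

Definition ideal_mul I J : set R :=
  ideal_gen [set z | exists a b, [/\ I a, J b & z = a * b]].

(** An ascending sequence of members of F without a largest one would have a
    finitely generated union, whose generators lie in a single member. *)
Lemma noetherian_maximal (F : set (set R)) E0 : noetherian R ->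
  (forall E, F E -> is_ideal E) -> F E0 ->
  exists E, F E /\ forall E', F E' -> E `<=` E' -> E' `<=` E.
Proof.
move=> hR Fid FE0; apply: contrapT => nmax.
have step (E : {E | F E}) :
    exists E' : {E | F E}, sval E `<=` sval E' /\ ~ sval E' `<=` sval E.
  case: E => E FE; apply: contrapT => h; apply: nmax; exists E; split=> //.
  move=> E' FE' sub; apply: contrapT => nsub; apply: h.
  by exists (exist _ E' FE').
have [f fP] := choice step.
pose u n := sval (iter n f (exist _ E0 FE0)).
have uid n : is_ideal (u n) by apply: Fid; exact: svalP.
have umono n m : (n <= m)%N -> u n `<=` u m.
  move=> /subnK <-; elim: (m - n)%N => // k IH.
  by apply: subset_trans IH _; rewrite addSn; apply: (fP _).1.
have : is_ideal [set x | exists n, u n x].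
  split; first by exists 0%N; apply: ideal0.
  move=> a x y [n ux] [m uy]; exists (maxn n m).
  apply: idealD => //; first apply: idealM => //.
    by apply: umono ux; exact: leq_maxl.
  by apply: umono uy; exact: leq_maxr.
move=> /hR[s defs].
have [n sn] : exists n, [set` s] `<=` u n.
  have : [set` s] `<=` [set x | exists n, u n x].
    by rewrite defs; apply: sub_ideal_gen.
  elim: s {defs} => [|x s IH] sub; first by exists 0%N.
  have [n ux] := sub x (mem_head x s).
  have [|m us] := IH; first by move=> y ys; apply: sub; rewrite /= inE ys orbT.
  exists (maxn n m) => y /=; rewrite inE => /orP[/eqP->|/us].
    by apply: umono ux; exact: leq_maxl.
  by apply: umono; exact: leq_maxr.
apply: (fP (iter n f (exist _ E0 FE0))).2 => x ux.
apply: (ideal_gen_sub (uid n) sn); rewrite -defs; exists n.+1; exact: ux.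
Qed.

(** A maximal member among the proper ideals E : e is prime. *)
Lemma colon_prime E : noetherian R -> is_ideal E -> ~ E 1 ->
  exists e, ~ E e /\ is_prime_ideal (colon E e).
Proof.
move=> hR hE E1.
have [||_ [[e [Ee ->]] emax]] := @noetherian_maximal
  [set A | exists e, ~ E e /\ A = colon E e] (colon E 1) hR.
- by move=> _ [e [_ ->]]; apply: colon_ideal.
- by exists 1.
exists e; split=> //; split.
  by split; [apply: colon_ideal|rewrite /colon /= mul1r].
move=> a b abe; have [Ebe|Ebe] := pselect (E (b * e)); [by right|left].
apply: (emax (colon E (b * e))); first by exists (b * e).
  by move=> c Ece; rewrite /colon /= mulrCA; apply: idealM.
by rewrite /colon /= mulrA.
Qed.

Lemma exists_prime_avoiding (S : set R) J : noetherian R -> is_ideal J ->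
  S 1 -> (forall x y, S x -> S y -> S (x * y)) -> (forall x, S x -> ~ J x) ->
  exists Q, J `<=` Q /\ forall x, S x -> ~ Q x.
Proof.
move=> hR hJ S1 SM SJ.
have [||Q [[hQ JQ SQ] Qmax]] := @noetherian_maximal
  [set A | [/\ is_ideal A, J `<=` A & forall x, S x -> ~ A x]] J hR.
- by move=> A [].
- by split.
have meets x : ~ Q x -> exists c y, Q y /\ S (c * x + y).
  move=> Qx; apply: contrapT => h; apply: Qx.
  apply: (Qmax (adjoin Q x)); [|exact: sub_adjoin|exact: adjoin_mem].
  split; [exact: adjoin_ideal|exact: subset_trans JQ (@sub_adjoin Q x)|].
  by move=> z Sz [c [y [Qy defz]]]; apply: h; exists c, y; rewrite -defz.
have Qprime : is_prime_ideal Q.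
  split; first by split=> // /(SQ _ S1).
  move=> x y Qxy; apply: contrapT => /not_orP[/meets[a [u [Qu Su]]]].
  move=> /meets[b [v [Qv Sv]]]; apply: SQ (SM _ _ Su Sv) _.
  have -> : (a * x + u) * (b * y + v) =
    (a * b) * (x * y) + (b * y + v) * u + (a * x) * v by ring.
  by do 2?apply: idealD => //; apply: idealM.
by exists (Spec Qprime).
Qed.

(** Nakayama's lemma for the local ring at P. If L is maximal among the
    saturated ideals between N and M other than M, any a in M outside L
    satisfies M = L + (a) locally, so that s a lies in L + P a for some s
    outside P, whence a is in L. *)
Lemma nakayama P N M : noetherian R -> is_ideal N -> is_ideal M -> N `<=` M ->
  (forall a, M a -> exists s n z,
     [/\ ~ P s, N n, ideal_mul P M z & s * a = n + z]) ->
  M `<=` saturation P N.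
Proof.
move=> hR hN hM NM hyp; apply: contrapT => nsub.
pose F := [set L | [/\ is_ideal L, N `<=` L, ~ M `<=` L &
   forall s a, ~ P s -> L (s * a) -> L a]].
have [||L [[hL NL ML Lsat] Lmax]] := @noetherian_maximal F (saturation P N) hR.
- by move=> L [].
- split=> //; [exact: saturation_ideal|exact: sub_saturation|].
  by move=> s a; apply: saturationK.
have [a [Ma La]] : exists a, M a /\ ~ L a.
  apply: contrapT => h; apply: ML => a Ma.
  by apply: contrapT => La; apply: h; exists a.
have full : M `<=` saturation P (adjoin L a).
  apply: contrapT => h; apply: La; apply: (Lmax (saturation P (adjoin L a))).
  - split=> //; first exact/saturation_ideal/adjoin_ideal.
      by move=> x /NL/(@sub_adjoin L a); apply: sub_saturation.
    by move=> s x; apply: saturationK.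
  - by move=> x /(@sub_adjoin L a); apply: sub_saturation.
  - exact/sub_saturation/adjoin_mem.
have hP := spec_ideal P.
have PM : ideal_mul P M `<=`
    [set z | exists t c l, [/\ ~ P t, P c, L l & t * z = c * a + l]].
  apply: ideal_gen_sub.
    split.
      exists 1, 0, 0; split; [exact: spec_1|exact: ideal0|exact: ideal0|ring].
    move=> b u v [t [c [l [Pt Pc Ll eu]]]] [t' [c' [l' [Pt' Pc' Ll' ev]]]].
    exists (t * t'), (t' * b * c + t * c'), (t' * b * l + t * l').
    split; [exact: spec_notM| | |].
    - by apply: idealD => //; apply: idealM.
    - by apply: idealD => //; apply: idealM.
    - have -> : t * t' * (b * u + v) = t' * b * (t * u) + t * (t' * v) by ring.
      by rewrite eu ev; ring.
  move=> _ [p [m [Pp /full[t [Pt [c [l [Ll e]]]]] ->]]].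
  exists t, (c * p), (p * l); split=> //; try exact: idealM.
  by rewrite mulrCA e; ring.
have [s [n [z [Ps Nn /PM[t [c [l [Pt Pc Ll ez]]]] ea]]]] := hyp a Ma.
apply: La; apply: (Lsat (t * s - c)).
  move=> h; apply: (spec_notM Pt Ps).
  by rewrite -(subrK c (t * s)); apply: idealD.
have -> : (t * s - c) * a = t * n + l.
  by rewrite mulrBl -mulrA ea mulrDr ez; ring.
by apply: idealD => //; apply: idealM => //; apply: NL.
Qed.

End IdealTheory.

(** * Chains of primes and Krull's height theorem *)

Section Heights.
Variable R : comNzRingType.
Hypothesis hR : noetherian R.
Implicit Types (E J : set R) (P Q : spec R) (c : nat -> spec R).

Definition extend_chain c n Q : nat -> spec R :=
  fun i => if (i <= n)%N then c i else Q.

Lemma extend_chainP c n Q : prime_chain c n -> c n `<` Q ->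
  prime_chain (extend_chain c n Q) n.+1.
Proof.
move=> cc cQ i; rewrite ltnS leq_eqVlt => /orP[/eqP->|lt_in].
  by rewrite /extend_chain leqnn ltnn.
by rewrite /extend_chain lt_in ltnW //; apply: cc.
Qed.

Lemma extend_chain_last c n Q : extend_chain c n Q n.+1 = Q.
Proof. by rewrite /extend_chain ltnn. Qed.

Lemma prime_chain_le c n i :
  prime_chain c n -> (i <= n)%N -> c i `<=` c n.
Proof.
move=> cc; elim: n cc => [|n IH] cc; first by rewrite leqn0 => /eqP->.
rewrite leq_eqVlt => /orP[/eqP->//|lt_in].
apply: subset_trans (cc n _).1 => //.
by apply: IH lt_in => k lt_k; apply: cc; apply: ltnW.
Qed.

(** Below a prime Q containing x_1, ..., x_(i+1), the multiplicative set of all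
    u x_(i+1)^n with u outside Q avoids (x_1, ..., x_i), because x_(i+1) can be
    cancelled modulo that ideal. A prime over (x_1, ..., x_i) avoiding it is
    the next one down. *)
Lemma regular_sequence_chain (s : seq R) P :
  regular_sequence s -> [set` s] `<=` P -> chain_lengths_to P (size s).
Proof.
move=> [reg _] sP.
suff descend i (Q : spec R) : (i <= size s)%N -> [set` take i s] `<=` Q ->
    chain_lengths_to Q i.
  by apply: descend => //; rewrite take_size.
elim: i Q => [|i IH] Q lt_i sQ; first by exists (fun=> Q).
pose x := s`_i; pose J := ideal_gen [set` take i s].
have JQ : J `<=` Q.
  apply: ideal_gen_sub (spec_ideal Q) _ => y ys; apply: sQ => /=.
  by rewrite (take_nth 0) // mem_rcons inE ys orbT.
have Qx : Q x by apply: sQ; rewrite /= (take_nth 0) // mem_rcons mem_head.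
pose S := [set z | exists u n, ~ Q u /\ z = u * x ^+ n].
have [|||Q' [JQ' SQ']] := @exists_prime_avoiding R S J hR (ideal_gen_ideal _).
- by exists 1, 0%N; rewrite mulr1; split=> //; apply: spec_1.
- move=> _ _ [u [n [Qu ->]]] [v [m [Qv ->]]]; exists (u * v), (n + m)%N.
  by split; [apply: spec_notM|rewrite exprD; ring].
- move=> _ [u [n [Qu ->]]]; elim: n => [|n JI]; first by rewrite mulr1 => /JQ.
  by rewrite exprS mulrCA => /(reg _ lt_i).
have [c cc cQ'] := IH Q' (ltnW lt_i) (subset_trans (@sub_ideal_gen _ _) JQ').
exists (extend_chain c i Q); last by rewrite extend_chain_last.
apply: extend_chainP => //; rewrite cQ'; split.
  move=> u Q'u; apply: contrapT => Qu; apply: SQ' Q'u.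
  by exists u, 0%N; rewrite mulr1.
move=> /(_ x Qx); apply: SQ'; exists 1, 1%N.
by rewrite mul1r; split=> //; apply: spec_1.
Qed.

(** Krull's principal ideal theorem, modulo P0. If no prime strictly between P0
    and P contained x, the local ring at P of R / (x, P0) would have no prime
    but the maximal one, hence satisfy the descending chain condition. Pick y in
    Q outside P0, and let J n be the contraction of the ideal (y^n) + P0 of the
    local ring at Q. Then J n is contained in J (n+1) + (x) locally at P for
    some n; as x is outside Q, Nakayama's lemma gives J n = J (n+1), and y^n
    lies in (y^(n+1)) + P0 locally at Q, which is absurd. *)
Lemma principal_ideal_theorem (P0 Q P : spec R) x : P0 `<` Q -> Q `<` P -> P x ->
  exists P' : spec R, [/\ P0 `<` P', P' `<` P & P' x].
Proof.
move=> [P0Q QP0] [QP PQ] Px; apply: contrapT => none.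
have P0x : ~ P0 x.
  by move=> P0x; apply: none; exists Q; split; [split|split|exact: P0Q].
have Qx : ~ Q x by move=> Qx; apply: none; exists Q; split.
have onlyP (P' : spec R) : P0 `<=` P' -> P' `<=` P -> P' x -> P `<=` P'.
  move=> P0P' P'P P'x; apply: contrapT => PP'; apply: none; exists P'.
  by split=> //; split=> // P'P0; apply: P0x; apply: P'P0.
have [y [Qy P0y]] : exists y, Q y /\ ~ P0 y.
  apply: contrapT => h; apply: QP0 => y Qy.
  by apply: contrapT => P0y; apply: h; exists y.
pose Y n := adjoin P0 (y ^+ n).
have Yid n : is_ideal (Y n) by apply: adjoin_ideal (spec_ideal P0).
pose J n := saturation Q (Y n).
have Jid n : is_ideal (J n) by apply: saturation_ideal.
have P0J n : P0 `<=` J n.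
  exact: subset_trans (@sub_adjoin _ _ _) (@sub_saturation _ _ _).
have JS n : J n.+1 `<=` J n.
  move=> z [s [Qs [a [p [P0p e]]]]]; exists s; split=> //.
  by exists (a * y), p; split=> //; rewrite e exprS; ring.
have JP n s z : ~ P s -> J n (s * z) -> J n z.
  by move=> Ps; apply: saturationK => /QP.
have hP := spec_ideal P.
(* E is good if the images of the J n modulo E are locally stationary. *)
pose good E := exists n0, forall n, (n0 <= n)%N -> forall a, J n a ->
  exists s b w, [/\ ~ P s, J n.+1 b, E w & s * a = b + w].
have goodP : good (adjoin P0 x).
  apply: contrapT => bad.
  have [||E [[hE P0E Ex badE] Emax]] := @noetherian_maximal R
      [set E | [/\ is_ideal E, P0 `<=` E, E x & ~ good E]] (adjoin P0 x) hR.
  - by move=> E [].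
  - have hP0 := spec_ideal P0.
    by split=> //; [exact: adjoin_ideal|exact: sub_adjoin|exact: adjoin_mem].
  pose E' := saturation P E.
  have hE' : is_ideal E' by apply: saturation_ideal.
  have EP : E `<=` P.
    move=> s Es; apply: contrapT => Ps; apply: badE; exists 0%N => n _ a Ja.
    exists s, 0, (a * s); split=> //; [exact: ideal0|exact: idealM|ring].
  have E'1 : ~ E' 1 by move=> [s [Ps]]; rewrite mulr1 => /EP.
  have [e [E'e ePrime]] := colon_prime hR hE' E'1.
  have colP : P `<=` colon E' e.
    apply: (onlyP (Spec ePrime)) => /=.
    - move=> z /P0E Ez; rewrite /colon /= mulrC.
      by apply: idealM => //; apply: sub_saturation.
    - move=> z E'ze; apply: contrapT => Pz; by apply/E'e/(saturationK Pz).
    - by rewrite /colon /= mulrC; apply: idealM => //; apply: sub_saturation.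
  have [n0 good_e] : good (adjoin E e).
    apply: contrapT => bad_e; apply: E'e; apply: sub_saturation.
    apply: (Emax (adjoin E e)); [|exact: sub_adjoin|exact: adjoin_mem].
    split=> //; first exact: adjoin_ideal.
      exact: subset_trans P0E (@sub_adjoin _ _ _).
    exact: sub_adjoin.
  apply: badE.
  (* As P kills e modulo E locally, (E + (e)) / E is a simple module over the
     local ring: the trace of J n on it is everything for all n, or zero from
     some n on. *)
  have [hits|] := pselect (forall n, exists t z w,
      [/\ ~ P t, J n z, E w & t * e = z + w]).
    exists n0 => n le_n a Ja.
    have [s [b [_ [Ps Jb [c [w [Ew ->]]] ea]]]] := good_e n le_n a Ja.
    have [t [z [v [Pt Jz Ev ee]]]] := hits n.+1.
    exists (t * s), (t * b + c * z), (c * v + t * w).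
    split; [exact: spec_notM| | |].
    - by apply: idealD => //; apply: idealM.
    - by apply: idealD => //; apply: idealM.
    - by rewrite -mulrA ea !mulrDr (mulrCA t c) ee; ring.
  move=> /existsNP[n1 miss]; exists (maxn n0 n1) => n.
  rewrite geq_max => /andP[le0 le1] a Ja.
  have [s [b [_ [Ps Jb [c [w [Ew ->]]] ea]]]] := good_e n le0 a Ja.
  have Jmono : J n `<=` J n1.
    move: le1 => /subnK <-; elim: (n - n1)%N => // k IH.
    by apply: subset_trans IH; rewrite addSn; apply: JS.
  have Pc : P c.
    apply: contrapT => Pc; apply: miss; exists c, (s * a - b), (- w).
    split=> //; [|exact: idealN|by rewrite ea; ring].
    by apply: Jmono; apply: idealB => //; [apply: idealM|apply: JS].
  have [t [Pt Etce]] := colP c Pc.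
  exists (t * s), (t * b), (t * (c * e) + t * w); split.
  - exact: spec_notM.
  - exact: idealM.
  - by apply: idealD => //; apply: idealM.
  - by rewrite -mulrA ea; ring.
have [n stable] := goodP.
have JJ : J n `<=` saturation P (J n.+1).
  apply: nakayama => // a Ja.
  have [s [b [_ [Ps Jb [c [p [P0p ->]]] ea]]]] := stable n (leqnn n) a Ja.
  have Jp := P0J n.+1 p P0p.
  have Jc : J n c.
    suff : J n (x * c) by apply: saturationK.
    have -> : x * c = s * a - (b + p) by rewrite ea; ring.
    by apply: idealB (Jid n) (idealM _ (Jid n) Ja) _; apply: JS; apply: idealD.
  exists s, (b + p), (x * c); split=> //; first exact: idealD.
    by apply: sub_ideal_gen; exists x, c.
  by rewrite ea; ring.
have [|s [/JP Ps /Ps]] := JJ (y ^+ n).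
  by apply: sub_saturation; apply: adjoin_mem (spec_ideal P0).
move=> [t [Qt [a [p [P0p e]]]]].
have : P0 (y ^+ n * (t - a * y)).
  suff -> : y ^+ n * (t - a * y) = p by [].
  by rewrite mulrBr [y ^+ n * t]mulrC e exprS; ring.
case/spec_prime => [/spec_X //|/P0Q Qtay]; apply: Qt.
rewrite -(subrK (a * y) t); apply: idealD => //; first exact: spec_ideal.
by apply: idealM => //; apply: spec_ideal.
Qed.

(** Descending along the chain, the principal ideal theorem replaces each
    intermediate prime by one that contains x. *)
Lemma prime_chain_exchange x n c : prime_chain c n.+1 -> c n.+1 x ->
  exists c', [/\ prime_chain c' n.+1, c' 0%N = c 0%N, c' n.+1 = c n.+1
    & c' 1%N x].
Proof.
elim: n c => [|n IH] c cc cx; first by exists c.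
have [P' [ltP' P'lt P'x]] :=
  principal_ideal_theorem (cc n (leqnSn _)) (cc n.+1 (leqnn _)) cx.
have cc1 : prime_chain (extend_chain c n P') n.+1.
  by apply: extend_chainP => // i lt_i; apply: cc; rewrite ltnW // ltnW.
have [|c' [cc' c'0 c'n c'1]] := IH _ cc1; first by rewrite extend_chain_last.
rewrite extend_chain_last in c'n.
exists (extend_chain c' n.+1 (c n.+2)); split=> //.
- by apply: extend_chainP => //; rewrite c'n.
- by rewrite extend_chain_last.
Qed.

(** Krull's height theorem, modulo c 0: after the exchange the chain without
    its first term ends in a prime minimal over c 1 and the remaining
    generators. *)
Lemma height_theorem (s : seq R) c n : prime_chain c n -> [set` s] `<=` c n ->
  (forall P', c 0%N `<=` P' -> P' `<=` c n -> [set` s] `<=` P' -> c n `<=` P') ->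
  (n <= size s)%N.
Proof.
elim: s c n => [|x s IH] c [//|n] cc sc cmin.
  have [le0 nle] : c 0%N `<` c n.+1.
    elim: n cc {sc cmin} => [|n IHn] cc; first exact: cc.
    have [le0 _] := IHn (fun i lt_i => cc i (ltnW lt_i)).
    have [len nle] := cc n.+1 (leqnn _).
    by split; [apply: subset_trans len|move=> /subset_trans/(_ le0)].
  by case: nle; apply: cmin => // y.
have [c' [cc' c'0 c'n c'x]] := prime_chain_exchange cc (sc x (mem_head x s)).
apply: (IH (fun i => c' i.+1)) => /=.
- by move=> i lt_i; apply: cc'.
- by rewrite c'n => y ys; apply: sc; rewrite /= inE ys orbT.
- rewrite c'n => P' c1P' P'c sP'; apply: cmin => //.
    by apply: subset_trans c1P'; rewrite -c'0; apply: (cc' 0%N _).1.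
  by move=> y /=; rewrite inE => /orP[/eqP->|/sP' //]; apply: c1P'.
Qed.

End Heights.

(** * Minors of a presentation, locally at a prime *)

Lemma sylvester_det (R : comNzRingType) (m n : nat)
    (X : 'M[R]_(m, n)) (Y : 'M[R]_(n, m)) :
  \det (1%:M + X *m Y) = \det (1%:M + Y *m X).
Proof.
have e : block_mx 1%:M (- X) Y 1%:M =
    block_mx 1%:M (- X) 0 1%:M *m block_mx (1%:M + X *m Y) 0 Y 1%:M.
  rewrite mulmx_block !(mul1mx, mulmx0, mul0mx, mulmx1, add0r).
  by rewrite mulNmx addrK.
have e' : block_mx 1%:M (- X) Y 1%:M =
    block_mx 1%:M 0 Y 1%:M *m block_mx 1%:M (- X) 0 (1%:M + Y *m X).
  rewrite mulmx_block !(mul1mx, mulmx0, mul0mx, mulmx1, add0r, addr0).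
  by rewrite mulmxN addrCA addNr addr0.
have := congr1 determinant (etrans (esym e) e').
by rewrite !det_mulmx !det_ublock !det_lblock !det1 !mul1r !mulr1.
Qed.

(** Placing the selected rows of A at the positions g a and unit vectors
    elsewhere turns a minor into a full determinant, without having to reorder
    the columns. *)
Lemma minor_full_det (R : comNzRingType) (t p r : nat) (A : 'M[R]_(p, r))
    (f : 'I_t -> 'I_p) (g : 'I_t -> 'I_r) : injective g ->
  exists B : 'M[R]_r, \det B = \det (mxsub f g A) /\
    forall a k, B (g a) k = A (f a) k.
Proof.
move=> g_inj; pose G : 'M[R]_(r, t) := \matrix_(i, a) (i == g a)%:R.
have mulG n (X : 'M[R]_(t, n)) a k : (G *m X) (g a) k = X a k.
  rewrite mxE (bigD1 a) //= mxE eqxx mul1r big1 ?addr0 // => b ba.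
  by rewrite mxE (inj_eq g_inj) eq_sym (negPf ba) mul0r.
pose F := rowsub f A.
have GG : G^T *m G = 1%:M.
  apply/matrixP => a b; rewrite !mxE (bigD1 (g a)) //= !mxE eqxx mul1r.
  rewrite (inj_eq g_inj) big1 ?addr0 // => i ia.
  by rewrite !mxE (negPf ia) mul0r.
exists (1%:M + G *m (F - G^T)); split.
  rewrite sylvester_det mulmxBl GG addrC subrK; congr determinant.
  apply/matrixP => a b; rewrite !mxE (bigD1 (g b)) //= !mxE eqxx mulr1.
  by rewrite big1 ?addr0 // => i ib; rewrite !mxE (negPf ib) mulr0.
move=> a k; rewrite [LHS]mxE mulG !mxE eq_sym.
by rewrite addrC subrK.
Qed.

Section LocalGenerators.
Variables (R : comNzRingType) (P : spec R) (r : nat) (w : 'I_r -> R).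

(** Since there are finitely many w_i, one denominator s serves them all. *)
Definition generates_at (G : {set 'I_r}) :=
  exists s, ~ P s /\ exists b : 'I_r -> 'I_r -> R,
    forall i, s * w i = \sum_(k in G) b i k * w k.

Lemma exists_minimal_generators : exists G, generates_at G /\
  forall G', generates_at G' -> (#|G| <= #|G'|)%N.
Proof.
have genT : `[< generates_at [set: 'I_r]%SET >].
  apply/asboolP; exists 1; split; first exact: spec_1.
  exists (fun i k => (k == i)%:R) => i.
  rewrite mul1r (bigD1 i) ?inE //= eqxx mul1r big1 ?addr0 //.
  by move=> k /andP[_ /negPf->]; rewrite mul0r.
have [G /asboolP genG Gmin] := 
  @arg_minnP _ _ (fun G => `[< generates_at G >]) (fun G => #|G|) genT.
by exists G; split=> // G' genG'; apply/Gmin/asboolP.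
Qed.

Variable G : {set 'I_r}.
Hypothesis genG : generates_at G.
Hypothesis Gmin : forall G', generates_at G' -> (#|G| <= #|G'|)%N.

(** A coefficient outside P would allow the corresponding generator to be
    eliminated. *)
Lemma minimal_relation c k0 : \sum_(k in G) c k * w k = 0 -> k0 \in G -> P (c k0).
Proof.
move=> rel Gk0; apply: contrapT => Pc.
have [s [Ps [b gen]]] := genG.
suff : generates_at (G :\ k0) by move=> /Gmin; rewrite (cardsD1 k0 G) Gk0 ltnn.
exists (c k0 * s); split; first exact: spec_notM.
exists (fun i k => c k0 * b i k - b i k0 * c k) => i.
move: rel; rewrite (big_setD1 k0) //= => /eqP; rewrite addrC addr_eq0 => /eqP rel.
under [RHS]eq_bigr do rewrite mulrBl -!mulrA.
rewrite big_split /= sumrN -!big_distrr /= rel.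
by rewrite -mulrA gen (big_setD1 k0) //=; ring.
Qed.

(** If w_i = sum_(k in G) b_ik w_k locally for i outside G, the matrix M
    rewrites a relation among all the w_i as one among those with k in G, so
    minimality puts the columns of B M indexed by G into P, in the t rows taken
    from A. In the Leibniz expansion each permutation sends at least t + #|G| -
    r of these rows into G, so it contributes two factors in P. *)
Lemma minors_in_square : exists u, ~ P u /\
  forall (p t : nat) (A : 'M[R]_(p, r)),
    (forall a, \sum_i A a i * w i = 0) -> (r + 2 <= t + #|G|)%N ->
  forall (f : 'I_t -> 'I_p) (g : 'I_t -> 'I_r), injective g ->
    ideal_mul P P (u * \det (mxsub f g A)).
Proof.
have [s [Ps [b gen]]] := genG.
pose N : 'M[R]_r := \matrix_(i, k) if (i \notin G) && (k \in G) then b i k else 0.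
pose M := s%:M + N.
have NN : N *m N = 0.
  apply/matrixP => i k; rewrite !mxE big1 // => l _; rewrite !mxE.
  by case: (l \in G); rewrite ?andbF /= ?mulr0 ?mul0r.
have MM : M *m (s%:M - N) = (s * s)%:M.
  rewrite mulmxDl !mulmxBr NN subr0 -scalar_mxM.
  by rewrite scalar_mxC subrK.
have PM : ~ P (\det M).
  move=> PdM; apply: Ps; apply: (@spec_X _ P s (r + r)).
  have := congr1 determinant MM.
  rewrite det_mulmx det_scalar exprMn -exprD => <-.
  by rewrite mulrC; apply: idealM => //; apply: spec_ideal.
have Mw i : \sum_(k in G) M i k * w k = s * w i.
  have [Gi|Gi] := boolP (i \in G).
    rewrite (bigD1 i) //= !mxE eqxx Gi addr0 big1 ?addr0 // => k /andP[_ ki].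
    by rewrite !mxE Gi eq_sym (negPf ki) addr0 mul0r.
  rewrite gen; apply: eq_bigr => k Gk; rewrite !mxE Gi Gk /=.
  by case: eqP Gi => [->|_ _]; rewrite ?Gk // add0r.
exists (\det M); split=> // p t A Aw card_t f g g_inj.
have AM a k : k \in G -> P ((A *m M) a k).
  apply: (minimal_relation (c := fun k => (A *m M) a k)).
  under eq_bigr do rewrite mxE big_distrl /=.
  rewrite exchange_big /=.
  transitivity (s * \sum_i A a i * w i); last by rewrite Aw mulr0.
  rewrite big_distrr; apply: eq_bigr => i _; under eq_bigr do rewrite -mulrA.
  by rewrite -big_distrr Mw /= mulrCA.
have [B [<- BA]] := minor_full_det A f g_inj.
have hPP : is_ideal (ideal_mul P P) by apply: ideal_gen_ideal.
rewrite mulrC -det_mulmx; apply: (ideal_sum _ hPP) => sigma _.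
apply: (idealM _ hPP).
have PBM a k : k \in G -> P ((B *m M) (g a) k).
  move=> /(AM (f a)); rewrite !mxE.
  by under [X in _ -> P X]eq_bigr do rewrite BA.
pose U := g @: [set: 'I_t]%SET; pose V := sigma @^-1: G.
have /card_gt1P[i [k [UVi UVk ne]]] : (1 < #|U :&: V|)%N.
  have := cardsUI U V; rewrite card_imset // cardsT card_ord.
  rewrite card_preimset; last exact: perm_inj.
  have := max_card (U :|: V); rewrite card_ord.
  by move: card_t; move: #|U :|: V| #|U :&: V| #|G| => x y z; lia.
move: UVi UVk ne => /setIP[/imsetP[a _ ->] Ga] /setIP[/imsetP[c _ ->] Gc] ne.
rewrite inE in Ga; rewrite inE in Gc.
rewrite (bigD1 (g a)) //= (bigD1 (g c)) /=; last by rewrite eq_sym.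
rewrite mulrA mulrC; apply: (idealM _ hPP); apply: sub_ideal_gen.
exists ((B *m M) (g a) (sigma (g a))), ((B *m M) (g c) (sigma (g c))).
by split=> //; apply: PBM.
Qed.

End LocalGenerators.

(** * Localization at a prime *)

Section LocalRing.
Variables (R S : comNzRingType) (P : spec R) (phi : {rmorphism R -> S}).
Hypothesis phi_unit : forall d, ~ P d -> exists v, v * phi d = 1.
Hypothesis phi_surj : forall x, exists a d, ~ P d /\ phi d * x = phi a.
Hypothesis phi_ker : forall a, phi a = 0 -> exists u, ~ P u /\ u * a = 0.
Implicit Types (Q : spec R) (J : set S).

Lemma phi_ideal J d x : is_ideal J -> ~ P d -> J (phi d * x) -> J x.
Proof.
move=> hJ Pd Jdx; have [v e] := phi_unit Pd.
by rewrite -[x]mul1r -e -mulrA; apply: idealM.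
Qed.

Lemma contraction_ideal J : is_ideal J -> is_ideal [set a | J (phi a)].
Proof.
move=> hJ; split; rewrite /= ?rmorph0; first exact: ideal0.
move=> a x y Jx Jy; rewrite rmorphD rmorphM.
by apply: idealD => //; apply: idealM.
Qed.

Lemma ideal_gen_map (s : seq R) a :
  ideal_gen [set` s] a -> ideal_gen [set` map phi s] (phi a).
Proof.
move=> sa; suff: ideal_gen [set` s] `<=`
  [set a | ideal_gen [set` map phi s] (phi a)] by apply.
apply: ideal_gen_sub => [|z sz]; first exact/contraction_ideal/ideal_gen_ideal.
by apply: sub_ideal_gen => /=; apply: map_f.
Qed.

Lemma local_noetherian : noetherian R -> noetherian S.
Proof.
move=> hR J hJ; have [s defJ] := hR _ (contraction_ideal hJ).
have hs := @ideal_gen_ideal S [set` map phi s].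
exists (map phi s); rewrite eqEsubset; split.
  move=> x Jx; have [a [d [Pd e]]] := phi_surj x.
  apply: (phi_ideal hs Pd); rewrite e.
  by apply: ideal_gen_map; rewrite -defJ /= -e; apply: idealM.
apply: ideal_gen_sub => // _ /mapP[a sa ->].
suff: [set a | J (phi a)] a by [].
by rewrite defJ; apply: sub_ideal_gen.
Qed.

Definition extension Q : set S :=
  [set x | exists a d, [/\ Q a, ~ P d & phi d * x = phi a]].

Lemma phi_eq a b : phi a = phi b -> exists u, ~ P u /\ u * a = u * b.
Proof.
move=> e; have [|u [Pu u0]] := @phi_ker (a - b); first by rewrite rmorphB e subrr.
by exists u; split=> //; apply/subr0_eq; rewrite -mulrBr.
Qed.

Lemma extensionK Q a : Q `<=` P -> extension Q (phi a) <-> Q a.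
Proof.
move=> QP; split; last first.
  by move=> Qa; exists a, 1; rewrite rmorph1 mul1r; split=> //; apply: spec_1.
move=> [b [d [Qb Pd]]]; rewrite -rmorphM => /phi_eq[u [Pu e]].
have : Q (u * d * a) by rewrite -mulrA e; apply: idealM => //; apply: spec_ideal.
by case/spec_prime => // /QP /(spec_notM Pu Pd).
Qed.

Lemma extension_prime Q : Q `<=` P -> is_prime_ideal (extension Q).
Proof.
move=> QP; have hQ := spec_ideal Q; split; last first.
  move=> x y; have [a [d [Pd ex]]] := phi_surj x.
  have [b [e [Pe ey]]] := phi_surj y.
  move=> [c [f [Qc Pf exy]]].
  have : Q (f * (a * b)).
    apply/(extensionK _ QP); exists (d * e * c), 1.
    split; [exact: idealM|exact: spec_1|].
    by rewrite rmorph1 mul1r !rmorphM -exy -ex -ey; ring.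
  case/spec_prime => [/QP //|/spec_prime[Qa|Qb]].
    by left; exists a, d.
  by right; exists b, e.
split; last first.
  by rewrite -(rmorph1 phi) (extensionK _ QP); apply: spec_1.
split; first by rewrite -(rmorph0 phi) (extensionK _ QP); apply: ideal0.
move=> z x y [a [d [Qa Pd ex]]] [b [e [Qb Pe ey]]].
have [c [f [Pf ez]]] := phi_surj z.
exists (e * c * a + d * f * b), (f * d * e).
split; first by apply: idealD => //; apply: idealM.
  by do 2?apply: spec_notM.
by rewrite rmorphD !rmorphM -ex -ey -ez; ring.
Qed.

Lemma local_maximal_spec : exists M : spec S, spec_set M = extension P.
Proof. by exists (Spec (extension_prime (@subset_refl _ P))). Qed.

Lemma proper_sub_maximal J : is_proper_ideal J -> J `<=` extension P.
Proof.
move=> [hJ J1] x Jx; have [a [d [Pd e]]] := phi_surj x.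
exists a, d; split=> //; apply: contrapT => Pa; apply: J1.
apply: (phi_ideal hJ Pa); rewrite mulr1 -e; exact: idealM.
Qed.

Lemma local_unique_maximal : unique_maximal_ideal (extension P).
Proof.
have [M defM] := local_maximal_spec.
have := specP M; rewrite defM => -[properP _].
move=> J; split=> [[properJ Jmax]|->].
  exact/esym/Jmax/proper_sub_maximal.
split=> // J' properJ' PJ'.
by rewrite eqEsubset; split=> //; apply: proper_sub_maximal.
Qed.

Lemma extension_lt (Q1 Q2 : spec R) : Q2 `<=` P -> Q1 `<` Q2 ->
  extension Q1 `<` extension Q2.
Proof.
move=> Q2P [Q12 Q21]; split.
  by move=> x [a [d [Qa Pd e]]]; exists a, d; split=> //; apply: Q12.
move=> sub; apply: Q21 => a /(extensionK a Q2P)/sub.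
by move/(extensionK a (subset_trans Q12 Q2P)).
Qed.

Lemma local_chain n : chain_lengths_to P n -> exists c : nat -> spec S,
  prime_chain c n /\ spec_set (c n) = extension P.
Proof.
move=> [c cc cP]; have [M defM] := local_maximal_spec.
have ext Q : exists Q' : spec S, Q `<=` P -> spec_set Q' = extension Q.
  have [QP|QP] := pselect (Q `<=` P); last by exists M.
  by exists (Spec (extension_prime QP)).
have [f fP] := choice ext; exists (f \o c); split; last by rewrite /= fP cP.
have cle i : (i <= n)%N -> c i `<=` P.
  by move=> le_in; rewrite -cP; apply: prime_chain_le.
move=> i lt_in /=; rewrite !fP; [|exact: cle|exact/cle/ltnW].
by apply: extension_lt; [exact: cle|exact: cc].
Qed.

(** Every chain of primes can be prolonged to end at the maximal ideal, so the
    height theorem bounds its length by the number of generators. *)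
Lemma local_chain_bound (g : seq S) n : noetherian R ->
  extension P = ideal_gen [set` g] -> @chain_lengths S n -> (n <= size g)%N.
Proof.
move=> hR defg [c cc]; have [M defM] := local_maximal_spec.
case: n cc => // n cc.
have cM i : c i `<=` M.
  by rewrite defM; apply: proper_sub_maximal; case: (specP (c i)).
apply: (height_theorem (local_noetherian hR) (c := extend_chain c n M)).
- apply: extend_chainP => [i lt_i|]; first exact/cc/ltnW.
  have [le_n nle] := cc n (leqnn _); split; first exact: cM.
  by move=> Mc; apply: nle; apply: subset_trans (cM _) Mc.
- by rewrite extend_chain_last defM defg; apply: sub_ideal_gen.
- move=> P' _ _ gP'; rewrite extend_chain_last defM defg.
  by apply: ideal_gen_sub gP'; apply: spec_ideal.
Qed.

(** A chain of d primes up to P, together with d elements generating P locally,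
    forces both dimension and embedding dimension to be d. *)
Lemma local_regular d (g : seq R) u : noetherian R -> chain_lengths_to P d ->
  size g = d -> [set` g] `<=` P -> ~ P u ->
  (forall a, P a -> ideal_gen [set` g] (u * a)) -> regular_local S.
Proof.
move=> hR chain size_g gP Pu gen.
have [M defM] := local_maximal_spec.
have defm : extension P = ideal_gen [set` map phi g].
  have hg := @ideal_gen_ideal S [set` map phi g].
  rewrite eqEsubset; split.
    move=> x [a [e [Pa Pe ex]]]; apply: (phi_ideal hg Pe); rewrite ex.
    apply: (phi_ideal hg Pu); rewrite -rmorphM.
    by apply: ideal_gen_map; apply: gen.
  apply: ideal_gen_sub; first by rewrite -defM; apply: spec_ideal.
  move=> _ /mapP[a ga ->]; apply/(extensionK a (@subset_refl _ P)).
  exact: gP.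
have [c [cc _]] := local_chain chain.
split; first exact: local_noetherian.
exists (extension P), d; split; first exact: local_unique_maximal.
  split; first by exists c.
  by move=> n cn; rewrite -size_g -(size_map phi g); apply: local_chain_bound cn.
split; first by exists (map phi g); rewrite size_map.
by move=> n [g' [<- defg']]; apply: local_chain_bound defg' _ => //; exists c.
Qed.

End LocalRing.

(** These three properties determine the ring of fractions up to isomorphism. *)
Lemma localization_morphism (R : comNzRingType) (P : spec R) :
  exists phi : {rmorphism R -> localization P},
  [/\ forall d, ~ P d -> exists v, v * phi d = 1,
      forall x, exists a d, ~ P d /\ phi d * x = phi a
    & forall a, phi a = 0 -> exists u, ~ P u /\ u * a = 0].
Proof.
pose f (a : R) : localization P :=
  \pi_(Localization.type P)%qT (a, Localization.den1 P).
have fB : zmod_morphism f.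
  move=> a b; rewrite /f !piE.
  by apply: Localization.pi_eq1 => /=; ring.
have fM : monoid_morphism f.
  split; first by [].
  by move=> a b; rewrite /f !piE; apply: Localization.pi_eq1 => /=; ring.
pose phiB := GRing.isZmodMorphism.Build _ _ f fB.
pose phiM := GRing.isMonoidMorphism.Build _ _ f fM.
pose phi : {rmorphism R -> localization P} := HB.pack f phiB phiM.
exists phi; split.
- move=> d /Localization.denP Pd.
  exists (\pi_(Localization.type P)%qT (1, exist _ d Pd)).
  rewrite /= /f !piE; apply: Localization.pi_eq1 => /=; ring.
- elim/quotW => -[a [d Pd]]; exists a, d; split; first exact/Localization.denP.
  by rewrite /= /f !piE; apply: Localization.pi_eq1 => /=; ring.
- move=> a /eqP; rewrite /= /f => /Localization.equivlP[[u Pu] /= e].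
  exists u; split; first exact/Localization.denP.
  by move: e; rewrite mulr1 mul0r mulr0.
Qed.

(** * Hilbert's basis theorem *)

Section HilbertBasis.
Variable A : comNzRingType.
Hypothesis hA : noetherian A.
Implicit Types (J : set {poly A}) (p q : {poly A}).

Definition coef_ideal J n : set A :=
  [set a | exists p, [/\ J p, (size p <= n.+1)%N & p`_n = a]].

Lemma coef_ideal_ideal J n : is_ideal J -> is_ideal (coef_ideal J n).
Proof.
move=> hJ; split.
  by exists 0; rewrite size_poly0 coef0; split=> //; apply: ideal0.
move=> a _ _ [p [Jp sp <-]] [q [Jq sq <-]]; exists (a%:P * p + q); split.
- by apply: idealD => //; apply: idealM.
- rewrite (leq_trans (size_polyD _ _)) // geq_max sq andbT mul_polyC.
  exact: leq_trans (size_scale_leq _ _) sp.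
- by rewrite coefD coefCM.
Qed.

Lemma size_sub_coef p q n : (size p <= n.+1)%N -> (size q <= n.+1)%N ->
  p`_n = q`_n -> (size (p - q)%R <= n)%N.
Proof.
move=> sp sq e; apply/leq_sizeP => k.
rewrite leq_eqVlt coefB => /orP[/eqP<-|lt_nk].
  by rewrite e subrr.
by rewrite !nth_default ?subrr //; [apply: leq_trans sq _|apply: leq_trans sp _].
Qed.

Lemma coef_ideal_generators J n : is_ideal J -> exists s : seq {poly A},
  [set` s] `<=` J /\ coef_ideal J n `<=` coef_ideal (ideal_gen [set` s]) n.
Proof.
move=> hJ; have [t deft] := hA (coef_ideal_ideal n hJ).
have lift a :
    exists p, coef_ideal J n a -> [/\ J p, (size p <= n.+1)%N & p`_n = a].
  have [[p Jp]|nJa] := pselect (coef_ideal J n a); first by exists p.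
  by exists 0.
have [f fP] := choice lift.
have tJ a : a \in t -> coef_ideal J n a.
  by move=> ta; rewrite deft; apply: sub_ideal_gen.
exists (map f t); split; first by move=> _ /mapP[a /tJ/fP[Jp _ _] ->].
rewrite deft; apply: ideal_gen_sub; first exact/coef_ideal_ideal/ideal_gen_ideal.
move=> a ta; have [_ sf fa] := fP a (tJ a ta); exists (f a); split=> //.
by apply: sub_ideal_gen; apply: map_f.
Qed.

(** The ideals of the coefficients in degree n of the elements of J of degree at
    most n increase with n, hence are constant from some N on. Elements of J
    with the right coefficients in the degrees up to N generate J, by induction
    on the degree. *)
Theorem hilbert_basis : noetherian {poly A}.
Proof.
move=> J hJ.
have coefS n m : (n <= m)%N -> coef_ideal J n `<=` coef_ideal J m.
  move=> le_nm _ [p [Jp sp <-]]; exists (p * 'X^(m - n)); split.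
  - by rewrite mulrC; apply: idealM.
  - rewrite (leq_trans (size_polyMleq _ _)) // size_polyXn addnS /=.
    by rewrite -[m in (_ <= m.+1)%N](subnKC le_nm) -addSn leq_add2r.
  - by rewrite coefMXn ltnNge leq_subr /= subKn.
have [|_ [[N ->] Nmax]] := @noetherian_maximal A
    [set E | exists n, E = coef_ideal J n] (coef_ideal J 0%N) hA _
    (ex_intro _ 0%N erefl).
  by move=> _ [n ->]; apply: coef_ideal_ideal.
have [gens gensP] := choice (fun n => coef_ideal_generators n hJ).
pose s := flatten [seq gens n | n <- iota 0 N.+1].
have sJ : [set` s] `<=` J.
  by move=> p /flattenP[_ /mapP[n _ ->]]; apply: (gensP n).1.
have hs := @ideal_gen_ideal _ [set` s].
have coef_s n : coef_ideal J n `<=` coef_ideal (ideal_gen [set` s]) n.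
  have low m : (m <= N)%N ->
      coef_ideal J m `<=` coef_ideal (ideal_gen [set` s]) m.
    move=> le_mN a /(gensP m).2[q [gq sq qa]]; exists q; split=> //.
    apply: ideal_genS gq => p gp; apply/flattenP; exists (gens m) => //.
    by apply: map_f; rewrite mem_iota.
  have [/low //|lt_Nn] := leqP n N.
  move=> a Ja; have [|q [gq sq <-]] := low N (leqnn N) a.
    by apply: (Nmax (coef_ideal J n)) Ja; [exists n|apply/coefS/ltnW].
  exists (q * 'X^(n - N)); split.
  - by rewrite mulrC; apply: (idealM _ hs).
  - rewrite (leq_trans (size_polyMleq _ _)) // size_polyXn addnS /=.
    by rewrite -[n in (_ <= n.+1)%N](subnKC (ltnW lt_Nn)) -addSn leq_add2r.
  - by rewrite coefMXn ltnNge leq_subr /= subKn // ltnW.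
exists s; rewrite eqEsubset; split; last exact: ideal_gen_sub.
suff by_size n p : (size p <= n)%N -> J p -> ideal_gen [set` s] p.
  by move=> p; apply: by_size (leqnn _).
elim: n p => [|n IH] p sp Jp.
  by move: sp; rewrite leqn0 size_poly_eq0 => /eqP->; apply: (ideal0 hs).
have [|q [gq sq pq]] := coef_s n p`_n; first by exists p.
rewrite -(subrK q p); apply: (idealD hs) => //; apply: IH.
  exact: size_sub_coef.
by apply: (idealB hJ Jp); apply: ideal_gen_sub gq.
Qed.

End HilbertBasis.

Lemma noetherian_surjection (A B : comNzRingType) (phi : {rmorphism A -> B}) :
  range phi = setT -> noetherian A -> noetherian B.
Proof.
move=> surj hA J hJ; have [s defs] := hA _ (contraction_ideal phi hJ).
exists (map phi s); rewrite eqEsubset; split.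
  move=> x Jx; have [a _ e] : range phi x by rewrite surj.
  by rewrite -e; apply: ideal_gen_map; rewrite -defs /= e.
apply: ideal_gen_sub => // _ /mapP[a sa ->].
suff: [set a | J (phi a)] a by [].
by rewrite defs; apply: sub_ideal_gen.
Qed.

Lemma field_noetherian (K : fieldType) : noetherian K.
Proof.
move=> J hJ; have [[a [Ja a0]]|none] := pselect (exists a, J a /\ a != 0).
  exists [:: 1]; have h1 := @ideal_gen_ideal K [set` [:: 1]].
  rewrite eqEsubset; split=> x _.
    rewrite -[x]mulr1; apply: (idealM _ h1).
    by apply: sub_ideal_gen; rewrite /= inE.
  by rewrite -[x](divfK a0); apply: idealM.
exists [::]; rewrite eqEsubset; split; last exact: (ideal_gen_sub hJ).
move=> x Jx; have [->|x0] := eqVneq x 0; first exact: ideal0 (ideal_gen_ideal _).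
by case: none; exists x.
Qed.

(** Adjoining the generators one at a time exhibits the algebra as a quotient of
    an iterated polynomial ring. *)
Lemma fg_algebra_noetherian (K : fieldType) (R : comNzRingType)
    (iota : {rmorphism K -> R}) : fg_algebra iota -> noetherian R.
Proof.
move=> [s fg].
have [A [phi [hA Kphi sphi]]] :
    exists (A : comNzRingType) (phi : {rmorphism A -> R}),
    [/\ noetherian A, range iota `<=` range phi & [set` s] `<=` range phi].
  elim: s {fg} => [|x s [A [phi [hA Kphi sphi]]]].
    by exists K, iota; split=> //; apply: field_noetherian.
  have cx : commr_rmorph phi x by move=> a; apply: mulrC.
  exists {poly A}, (horner_morph cx).
  have sub : range phi `<=` range (horner_morph cx).
    by move=> _ [a _ <-]; exists a%:P => //; apply: horner_morphC.
  split; [exact: hilbert_basis|exact: subset_trans sub|].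
  move=> y /=; rewrite inE => /orP[/eqP->|/sphi/sub //].
  by exists 'X => //; apply: horner_morphX.
apply: (@noetherian_surjection A R phi) => //; rewrite eqEsubset; split=> // x _.
have : smallest (is_subalgebra iota) [set` s] x by rewrite fg.
apply; split=> //; split=> //.
  by move=> _ _ [a _ <-] [b _ <-]; exists (a - b) => //; apply: rmorphB.
by move=> _ _ [a _ <-] [b _ <-]; exists (a * b) => //; apply: rmorphM.
Qed.

(** * Ideals equal to one of their Fitting ideals *)

Lemma row_linear_sum (R : comNzRingType) r (pi : {linear 'rV[R]_r -> R^o})
    (v : 'rV[R]_r) :
  pi v = \sum_i v 0 i * (pi (delta_mx 0 i) : R).
Proof.
rewrite [v in LHS]row_sum_delta linear_sum /=.
by apply: eq_bigr => i _; rewrite linearZ.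
Qed.

Section FittingFixedIdeal.
Variables (R : comNzRingType) (I : set R) (j : nat).
Hypotheses (hR : noetherian R) (hI : is_ideal I) (j_gt0 : (0 < j)%N).
Hypothesis I_Fitt : @Fitt R R^o I (j - 1) = I.
Variables (y : R) (Iy : I y) (y_reg : forall z, y * z = 0 -> z = 0).

Lemma fitting_presentation :
  exists (r p : nat) (w : 'I_r -> R) (A : 'M[R]_(p, r)),
  [/\ forall i, I (w i),
      forall a, I a -> exists v : 'I_r -> R, a = \sum_i v i * w i,
      forall a, \sum_i A a i * w i = 0
    & I = minors_ideal (r - (j - 1)) A].
Proof.
move: I_Fitt; rewrite /Fitt; set X := (X in xget _ X) => defI.
have : X I.
  rewrite -[in X I]defI; apply: xgetPex; apply: contrapT => none.
  have := ideal0 hI; rewrite -defI xgetPN // => J XJ.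
  by apply: none; exists J.
move=> [r [p [pi [A [[range_pi ker_pi] defIA]]]]].
exists r, p, (fun i => pi (delta_mx 0 i)), A; split=> //.
- by move=> i; rewrite -[I]range_pi; exists (delta_mx 0 i).
- move=> a; rewrite -[I]range_pi => -[v _ <-]; exists (fun i => v 0 i).
  exact: row_linear_sum.
- move=> a; have : [set v | pi v = 0] (row a A).
    by rewrite ker_pi; exists (delta_mx 0 a) => //; rewrite rowE.
  move=> /= pi_row; apply: etrans pi_row; rewrite row_linear_sum.
  by apply: eq_bigr => i _; rewrite mxE.
Qed.

(** If I = P locally at P and more than j generators were needed there, all the
    minors generating the Fitting ideal, and with them P, would lie in P^2
    locally; so P would vanish locally by Nakayama's lemma, although it contains
    a nonzerodivisor. *)
Lemma few_local_generators (P : spec R) x : I `<=` P -> ~ P x ->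
  (forall a, P a -> I (x * a)) ->
  exists (s : seq R) u, [/\ (size s <= j)%N, [set` s] `<=` I, ~ P u
    & forall a, P a -> ideal_gen [set` s] (u * a)].
Proof.
move=> IP Px xPI; have [r [p [w [A [Iw genI Aw defI]]]]] := fitting_presentation.
have [G [genG Gmin]] := exists_minimal_generators P w.
have le_Gj : (#|G| <= j)%N.
  rewrite leqNgt; apply/negP => lt_jG.
  have [u [Pu minors]] := minors_in_square genG Gmin.
  have le_Gr : (#|G| <= r)%N by have := max_card G; rewrite card_ord.
  have hPP : is_ideal (ideal_mul P P) by apply: ideal_gen_ideal.
  have uI : I `<=` [set a | ideal_mul P P (u * a)].
    rewrite defI; apply: ideal_gen_sub.
      split=> [|a b c Pb Pc]; first by rewrite /= mulr0; apply: (ideal0 hPP).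
      rewrite /= mulrDr mulrCA; apply: (idealD hPP) => //.
      exact: (idealM _ hPP).
    by move=> _ [f [g [_ g_inj ->]]]; apply: (minors _ _ A) => //; lia.
  have hP := spec_ideal P.
  pose Z : set R := [set 0].
  have hZ : is_ideal Z by split=> // a b c -> ->; rewrite /Z /= mulr0 addr0.
  have PZ : P `<=` saturation P Z.
    apply: nakayama => // [_ ->|a Pa]; first exact: ideal0.
    exists (u * x), 0, (u * (x * a)); split=> //; first exact: spec_notM.
      exact: (uI _ (xPI a Pa)).
    by rewrite add0r mulrA.
  have [s [Ps s0]] := PZ y (IP y Iy).
  apply: Ps; have -> : s = 0 by apply: y_reg; rewrite mulrC.
  exact: ideal0.
have [s [Ps [b gen]]] := genG.
exists [seq w k | k in G], (s * x); split.
- by rewrite size_image.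
- by move=> _ /mapP[k _ ->].
- exact: spec_notM.
move=> a /xPI/genI[v e]; rewrite -mulrA e big_distrr /=.
have hs := @ideal_gen_ideal R [set` [seq w k | k in G]].
apply: (ideal_sum _ hs) => i _; rewrite mulrCA gen; apply: (idealM _ hs).
apply: (ideal_sum _ hs) => k Gk; apply: (idealM _ hs).
by apply: sub_ideal_gen; apply: map_f; rewrite mem_enum.
Qed.

End FittingFixedIdeal.

Lemma Ass_radical (R : comNzRingType) (I : set R) (P : spec R) :
  is_radical_ideal I -> Ass I P ->
  I `<=` P /\ exists x, ~ P x /\ forall a, P a -> I (x * a).
Proof.
move=> [hI rad] [x defP].
have PE a : P a <-> I (a * x) by rewrite defP.
split; first by move=> a Ia; apply/PE; rewrite mulrC; apply: idealM.
exists x; split; last by move=> a /PE; rewrite mulrC.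
move=> /PE xx; apply: (@spec_1 _ P); apply/PE; rewrite mul1r.
exact: (rad x 2).
Qed.

Theorem proposition3p2 (R : comNzRingType)
    (hR : noetherian_local R \/ fg_graded_algebra R)
    (j : nat) (hj : (2 <= j)%N)
    (I : set R) (I_proper : is_proper_ideal I) (I_radical : is_radical_ideal I)
    (I_grade : (j <= grade I)%N)
    (I_Fitt : @Fitt R R^o I (j - 1) = I) :
  [/\ unmixed I, grade I = j
    & forall P : spec R, Ass I P -> regular_local (localization P)].
Proof.
have noethR : noetherian R.
  by case: hR => [[]//|[K [iota [fg _]]]]; apply: fg_algebra_noetherian fg.
have [hI I1] := I_proper.
have j_gt0 : (0 < j)%N by apply: leq_trans hj.
have [s [s_reg sI _] size_s] :
    exists2 s, maximal_regular_sequence_in I s & size s = grade I.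
  move: (leq_trans j_gt0 I_grade); rewrite /grade.
  case: xgetP => [n -> [s [sP <-]] _|_ //]; first by exists s.
have s_gt0 : (0 < size s)%N by rewrite size_s (leq_trans j_gt0).
have Is0 : I s`_0 by apply: sI; apply: mem_nth.
have s0_reg z : s`_0 * z = 0 -> z = 0.
  move=> e; have : ideal_gen [set` take 0 s] z.
    by apply: (s_reg.1 0%N s_gt0); rewrite e; exact: ideal0 (ideal_gen_ideal _).
  suff: ideal_gen [set` take 0 s] `<=` [set 0] by apply.
  rewrite take0; apply: ideal_gen_sub => //.
  by split=> // a b c -> ->; rewrite mulr0 addr0.
have chain (P : spec R) : I `<=` P -> chain_lengths_to P (grade I).
  move=> IP; rewrite -size_s.
  by apply: regular_sequence_chain => //; apply: subset_trans IP.
have gens (P : spec R) : Ass I P -> exists (g : seq R) u,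
    [/\ (size g <= j)%N, [set` g] `<=` I, ~ P u
      & forall a, P a -> ideal_gen [set` g] (u * a)].
  move=> /(Ass_radical I_radical)[IP [x [Px xPI]]].
  exact: (few_local_generators noethR hI j_gt0 I_Fitt Is0 s0_reg IP Px xPI).
have bound (P : spec R) (g : seq R) u n : Ass I P -> [set` g] `<=` I -> ~ P u ->
    (forall a, P a -> ideal_gen [set` g] (u * a)) ->
    chain_lengths_to P n -> (n <= size g)%N.
  move=> /(Ass_radical I_radical)[IP _] gI Pu gen [c cc cP].
  apply: (height_theorem noethR cc); rewrite cP; first exact: subset_trans IP.
  move=> P' _ P'P gP' a Pa.
  have : P' (u * a) by apply: (ideal_gen_sub (spec_ideal P') gP'); apply: gen.
  by case/spec_prime => // /P'P.
have [x [Ix colonP]] := colon_prime noethR hI I1.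
pose P0 := Spec colonP; have AP0 : Ass I P0 by exists x.
have gradeI : grade I = j.
  apply/eqP; rewrite eqn_leq I_grade andbT.
  have [g [u [size_g gI Pu gen]]] := gens P0 AP0.
  apply: leq_trans size_g; apply: (bound P0 g u) => //.
  exact/chain/(Ass_radical I_radical AP0).1.
rewrite gradeI in chain.
have heightP P : Ass I P -> prime_height P j.
  move=> AP; split; first exact/chain/(Ass_radical I_radical AP).1.
  have [g [u [size_g gI Pu gen]]] := gens P AP.
  by move=> n /(bound P g u n AP gI Pu gen) le_n; apply: leq_trans size_g.
split=> // [|P AP].
  exists j; split=> //; split.
    by exists P0; split; [exact: (Ass_radical I_radical AP0).1|exact: heightP].
  by move=> h [Q [IQ [_]]]; apply; apply: chain.
have [g [u [size_g gI Pu gen]]] := gens P AP.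
have IP := (Ass_radical I_radical AP).1.
have [phi [phi_unit phi_surj phi_ker]] := localization_morphism P.
apply: (local_regular phi_unit phi_surj phi_ker noethR _ _ _ Pu gen).
- exact: chain.
- apply/eqP; rewrite eqn_leq size_g; apply: (bound P g u) => //; exact: chain.
- exact: subset_trans IP.
Qed.
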